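(* Let $\mathbb{V}$ be an $n$-dimensional vector space ($n\ge 1$) over a finite field $\mathbb{F}$ with $q$ elements, with basis $\{\alpha_1,\ldots,\alpha_n\}$, and let $\Gamma(\mathbb{V})$ be its non-zero component graph with respect to this basis. If $q=2$, then the clique number of $\Gamma(\mathbb{V})$ is $\omega(\Gamma(\mathbb{V}))=2^{n-1}$.
   Context: Let $\theta$ be the null vector of $\mathbb{V}$. Every $\mathbf{a}\in\mathbb{V}$ is written uniquely as $\mathbf{a}=a_1\alpha_1+\cdots+a_n\alpha_n$. The non-zero component graph $\Gamma(\mathbb{V})$ with respect to the basis $\{\alpha_1,\ldots,\alpha_n\}$ is the simple graph with vertex set $\mathbb{V}\setminus\{\theta\}$ in which two distinct vertices $\mathbf{a},\mathbf{b}$ are adjacent if and only if there is at least one $i$ such that the coefficients of $\alpha_i$ in $\mathbf{a}$ and in $\mathbf{b}$ are both non-zero. The clique number $\omega(G)$ is the maximum size of a set of pairwise adjacent vertices of $G$. *)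

(* Defs.v *)
From HB Require Import structures.
From mathcomp Require Import all_boot all_order all_algebra all_field.

Set Implicit Arguments.
Unset Strict Implicit.
Unset Printing Implicit Defensive.

Import GRing.Theory.
Local Open Scope ring_scope.

Record sgraph := SGraph {
  vertex : finType;
  adj : rel vertex;
  adj_sym : symmetric adj;
  adj_irrefl : irreflexive adj }.

Definition clique (G : sgraph) (S : {set vertex G}) : bool :=
  [forall x in S, forall y in S, (x != y) ==> adj x y].

Definition clique_number (G : sgraph) : nat :=
  \max_(S : {set vertex G} | clique S) #|S|.

Section NonZeroComponentGraph.

Variables (F : finFieldType) (V : vectType F) (n : nat) (alpha : n.-tuple V).

(* finvect_type V is V itself, equipped with the finType structure that a
   finite-dimensional space over a finite field has. *)
Definition nonzero_vector : finType := {v : finvect_type V | v != 0}.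

(* When alpha is a basis, coord alpha i v is the coefficient of alpha_i in v;
   it is only meaningful under that hypothesis. *)
Definition nzc_adj (a b : nonzero_vector) : bool :=
  (a != b) &&
  [exists i : 'I_n, (coord alpha i (val a) != 0) && (coord alpha i (val b) != 0)].

Lemma nzc_adj_sym : symmetric nzc_adj.
Proof.
move=> a b; rewrite /nzc_adj eq_sym; congr (_ && _).
by apply: eq_existsb => i; rewrite andbC.
Qed.

Lemma nzc_adj_irrefl : irreflexive nzc_adj.
Proof. by move=> a; rewrite /nzc_adj eqxx. Qed.

Definition nzc_graph : sgraph := SGraph nzc_adj_sym nzc_adj_irrefl.

End NonZeroComponentGraph.

(* Main.v *)
Require Import Defs.
From mathcomp Require Import all_boot all_order all_algebra all_field.

Set Implicit Arguments.
Unset Strict Implicit.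
Unset Printing Implicit Defensive.

Import GRing.Theory.
Local Open Scope ring_scope.

(** Over a field with two elements a vector is determined by its support, the
    set of basis indices at which its coefficient is non-zero, and every set of
    indices is a support.  Two vectors are adjacent exactly when they are
    distinct and their supports meet, so cliques correspond to intersecting
    families of subsets of an [n]-element set, and the clique number is the
    largest size of such a family.

    An intersecting family contains at most one set of each complementary pair
    [A], [~: A], hence at most half of all subsets ([card_intersecting]).  The
    sets containing a fixed index form an intersecting family with exactly one
    set of each pair, so the bound [2 ^ (n - 1)] is attained ([card_star]).
    Injectivity of the support ([supp_inj]) carries the upper bound over to
    cliques, and surjectivity ([supp_surj]) the lower one. *)

Section IntersectingFamilies.

Variable T : finType.
Implicit Types (A B : {set T}) (E : {set {set T}}).

(** Complementation is a bijection from [E] onto a family disjoint from [E]: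
    a common member would be a set of [E] whose complement is also in [E]. *)
Lemma card_intersecting E :
  {in E &, forall A B, A :&: B != set0} -> (#|E|.*2 <= 2 ^ #|T|)%N.
Proof.
move=> meetE.
have sub_compl : [set ~: A | A in E] \subset ~: E.
  apply/subsetP=> _ /imsetP[A EA ->]; rewrite inE; apply/negP=> EcA.
  by have := meetE _ _ EA EcA; rewrite setICr eqxx.
have := subset_leq_card sub_compl.
rewrite (card_imset _ (inv_inj (@setCK T))) -(leq_add2l #|E|) cardsC addnn.
by rewrite -cardsT -powersetT card_powerset cardsT.
Qed.

(** Complementation exchanges the sets that contain [x] and those that do
    not. *)
Lemma card_star (x : T) : (#|[set A : {set T} | x \in A]|.*2 = 2 ^ #|T|)%N.
Proof.
set E := [set A | _].
have compl_star : [set ~: A | A in E] = ~: E.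
  apply/setP=> A; rewrite -{1}(setCK A) (mem_imset _ _ (inv_inj (@setCK T))).
  by rewrite !inE.
rewrite -addnn -{2}(card_imset (mem E) (inv_inj (@setCK T))) compl_star cardsC.
by rewrite -cardsT -powersetT card_powerset cardsT.
Qed.

End IntersectingFamilies.

Lemma neq0_card2 (F : finFieldType) (x : F) : #|F| = 2%N -> x != 0 -> x = 1.
Proof.
move=> cardF x0; apply/eqP; apply: contraTT isT => x1.
(* Otherwise 0, 1 and x would be three distinct elements. *)
have : (#|[set 0; 1; x]%R| <= #|F|)%N by exact: max_card.
rewrite cardF -setUA cardsU1 cards2 !inE eq_sym oner_eq0 /=.
by rewrite eq_sym (negPf x0) eq_sym x1.
Qed.

Section Support.

Variables (F : finFieldType) (V : vectType F) (n : nat) (alpha : n.-tuple V).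
Hypotheses (alpha_basis : basis_of fullv alpha) (cardF : #|F| = 2%N).

Definition supp (a : nonzero_vector V) : {set 'I_n} :=
  [set i | coord alpha i (val a) != 0].

Lemma nzc_adjE (a b : nonzero_vector V) :
  nzc_adj alpha a b = (a != b) && (supp a :&: supp b != set0).
Proof.
congr (_ && _); apply/existsP/set0Pn => -[i iab]; exists i;
  by move: iab; rewrite !inE.
Qed.

Lemma supp_neq0 a : supp a != set0.
Proof.
apply/negP=> /eqP a0; have /negP[] := valP a; apply/eqP.
rewrite [LHS](coord_basis alpha_basis (memvf (val a : V))) big1 // => i _.
have := in_set0 i; rewrite -a0 inE => /negbFE/eqP ->.
by rewrite scale0r.
Qed.

(** A non-zero coefficient can only be [1], so equal supports force equal
    coefficients. *)
Lemma supp_inj : injective supp.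
Proof.
move=> a b /setP eqab; apply: val_inj.
rewrite [LHS](coord_basis alpha_basis (memvf (val a : V))).
rewrite [RHS](coord_basis alpha_basis (memvf (val b : V))).
apply: eq_bigr => i _; congr (_ *: _); have := eqab i; rewrite !inE.
have [-> /esym/negbFE/eqP -> // | a0] := eqVneq (coord alpha i (val a)) 0.
by move/esym=> b0; rewrite (neq0_card2 cardF a0) (neq0_card2 cardF b0).
Qed.

Lemma supp_surj (A : {set 'I_n}) : A != set0 -> exists a, supp a = A.
Proof.
move=> /set0Pn[j jA].
pose v : V := \sum_(i < n) (i \in A)%:R *: alpha`_i.
have coord_v i : coord alpha i v = (i \in A)%:R.
  by rewrite coord_sum_free // (basis_free alpha_basis).
have v0 : (v : finvect_type V) != 0.
  apply/negP=> /eqP v0; have := coord_v j.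
  by rewrite jA v0 linear0 => /esym/eqP; rewrite oner_eq0.
exists (Sub v v0); apply/setP=> i; rewrite inE SubK coord_v.
by case: (i \in A); rewrite ?oner_eq0 ?eqxx.
Qed.

(** The condition also covers [a = b], where it holds because vertices are
    non-zero vectors. *)
Lemma clique_supp (S : {set vertex (nzc_graph alpha)}) :
  reflect {in S &, forall a b, supp a :&: supp b != set0}
    (@clique (nzc_graph alpha) S).
Proof.
apply: (iffP idP) => [/forall_inP cS a b aS bS | meetS].
  have [<-|nab] := eqVneq a b; first by rewrite setIid supp_neq0.
  have /forall_inP/(_ _ bS)/implyP/(_ nab) := cS _ aS.
  by rewrite /= nzc_adjE => /andP[].
apply/forall_inP=> a aS; apply/forall_inP=> b bS; apply/implyP=> nab.
by rewrite /= nzc_adjE; apply/andP; split; last exact: meetS.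
Qed.

End Support.

Theorem corollary4p1 (F : finFieldType) (V : vectType F) (n : nat)
    (alpha : n.-tuple V) (hn : (1 <= n)%N) (halpha : basis_of fullv alpha)
    (hq : #|F| = 2%N) :
  clique_number (nzc_graph alpha) = (2 ^ (n - 1))%N.
Proof.
have two_pow : (2 ^ #|'I_n| = (2 ^ (n - 1)).*2)%N.
  by rewrite card_ord -mul2n -expnS subn1 prednK.
have injs := supp_inj halpha hq.
apply/eqP; rewrite eqn_leq; apply/andP; split.
  apply/bigmax_leqP=> S /(clique_supp halpha) meetS.
  rewrite -leq_double -two_pow -(card_imset (mem S) injs).
  apply: card_intersecting => _ _ /imsetP[a aS ->] /imsetP[b bS ->].
  exact: meetS.
pose i0 := Ordinal hn.
pose S0 : {set vertex (nzc_graph alpha)} := [set a | i0 \in supp alpha a].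
have star_S0 : [set supp alpha a | a in S0] = [set A : {set 'I_n} | i0 \in A].
  apply/setP=> A; rewrite inE; apply/imsetP/idP => [[a aS ->]|i0A].
    by move: aS; rewrite inE.
  have [|a aA] := supp_surj halpha (A := A); first by apply/set0Pn; exists i0.
  by exists a; rewrite // inE aA.
have cardS0 : #|S0| = (2 ^ (n - 1))%N.
  apply: double_inj; rewrite -two_pow -(card_star i0) -star_S0.
  by rewrite (card_imset (mem S0) injs).
rewrite -cardS0; apply: (@leq_bigmax_cond _ _ (fun S => #|pred_of_set S|)).
apply/(clique_supp halpha) => a b; rewrite !inE => ai bi.
by apply/set0Pn; exists i0; rewrite !inE ai bi.
Qed.
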